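(* Let $m\geq 1$ be an integer and let $\{R_i\}_{i=1,\dots,m}$ be a family of commutative rings. Then $$\mathrm{G\text{-}gldim}\Big(\prod_{i=1}^m R_i\Big)=\sup\{\mathrm{G\text{-}gldim}(R_i)\mid 1\leq i\leq m\}.$$
   Context: All rings are commutative with identity element and all modules are unital; no Noetherian hypothesis is made. An $R$-module $M$ is Gorenstein projective if there is an exact sequence of projective $R$-modules $\mathbf{P}=\cdots\to P_1\to P_0\to P^0\to P^1\to\cdots$ such that $M\cong \mathrm{Im}(P_0\to P^0)$ and such that $\mathrm{Hom}_R(-,Q)$ leaves $\mathbf{P}$ exact for every projective $R$-module $Q$. The Gorenstein projective dimension $\mathrm{Gpd}_R(M)$ of an $R$-module $M$ is the least integer $n\geq 0$ such that there is an exact sequence $0\to G_n\to\cdots\to G_0\to M\to 0$ with all $G_i$ Gorenstein projective, and $\infty$ if no such $n$ exists. The Gorenstein global dimension of $R$ is $\mathrm{G\text{-}gldim}(R)=\sup\{\mathrm{Gpd}_R(M)\mid M \text{ an } R\text{-module}\}\in\mathbb{N}\cup\{\infty\}$. (It is known that this equals the supremum of the Gorenstein injective dimensions of all $R$-modules.) *)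

(* Defs.v *)
From HB Require Import structures.
From mathcomp Require Import all_boot all_order all_algebra.
From mathcomp Require Import boolp.

Set Implicit Arguments.
Unset Strict Implicit.
Unset Printing Implicit Defensive.

Import GRing.Theory.
Local Open Scope ring_scope.

(* The ordered set N ∪ {∞}. *)
Variant enat := Fin of nat | Infty.

Definition ele (x y : enat) : Prop :=
  match x, y with
  | _, Infty => True
  | Infty, Fin _ => False
  | Fin m, Fin n => (m <= n)%N
  end.

(* Least natural number satisfying P; Infty if there is none. *)
Definition einf (P : nat -> Prop) : enat :=
  match pselect (exists n, `[< P n >]) with
  | left exP => Fin (ex_minn exP)
  | right _ => Infty
  end.

(* Every subset of N ∪ {∞} has a supremum: its least natural upper bound, or
   Infty when no natural number bounds it; see esup_ub and esup_least. The
   index type is not required to be small, so that it can be a type of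
   modules. *)
Definition esup (I : Type) (f : I -> enat) : enat :=
  einf (fun n => forall i, ele (f i) (Fin n)).

Lemma esup_ub (I : Type) (f : I -> enat) (i : I) : ele (f i) (esup f).
Proof.
rewrite /esup /einf; case: pselect => [exP|_]; last by case: (f i).
by case: ex_minnP => n /asboolP.
Qed.

Lemma esup_least (I : Type) (f : I -> enat) (b : enat) :
  (forall i, ele (f i) b) -> ele (esup f) b.
Proof.
case: b => [b|] ub; last by case: (esup f).
rewrite /esup /einf; case: pselect => [exP|[]]; last by exists b; apply/asboolP.
by case: ex_minnP => n _; apply; apply/asboolP.
Qed.

Section ProductRing.
Variables (I : finType) (R : I -> comPzRingType).

Definition prodRing : Type := {dffun forall i : I, R i}.

HB.instance Definition _ := Choice.on prodRing.

Implicit Types f g h : prodRing.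

Definition prodRing_zero : prodRing := [ffun i : I => 0 : R i].
Definition prodRing_one : prodRing := [ffun i : I => 1 : R i].
Definition prodRing_opp f : prodRing := [ffun i : I => - f i].
Definition prodRing_add f g : prodRing := [ffun i : I => f i + g i].
Definition prodRing_mul f g : prodRing := [ffun i : I => f i * g i].

Fact prodRing_addA : associative prodRing_add.
Proof. by move=> f g h; apply/ffunP => i; rewrite !ffunE addrA. Qed.
Fact prodRing_addC : commutative prodRing_add.
Proof. by move=> f g; apply/ffunP => i; rewrite !ffunE addrC. Qed.
Fact prodRing_add0 : left_id prodRing_zero prodRing_add.
Proof. by move=> f; apply/ffunP => i; rewrite !ffunE add0r. Qed.
Fact prodRing_addN : left_inverse prodRing_zero prodRing_opp prodRing_add.
Proof. by move=> f; apply/ffunP => i; rewrite !ffunE addNr. Qed.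

HB.instance Definition _ := GRing.isZmodule.Build prodRing
  prodRing_addA prodRing_addC prodRing_add0 prodRing_addN.

Fact prodRing_mulA : associative prodRing_mul.
Proof. by move=> f g h; apply/ffunP => i; rewrite !ffunE mulrA. Qed.
Fact prodRing_mulC : commutative prodRing_mul.
Proof. by move=> f g; apply/ffunP => i; rewrite !ffunE mulrC. Qed.
Fact prodRing_mul1 : left_id prodRing_one prodRing_mul.
Proof. by move=> f; apply/ffunP => i; rewrite !ffunE mul1r. Qed.
Fact prodRing_mulDl : left_distributive prodRing_mul +%R.
Proof. by move=> f g h; apply/ffunP => i; rewrite !ffunE mulrDl. Qed.

HB.instance Definition _ := GRing.Zmodule_isComPzRing.Build prodRing
  prodRing_mulA prodRing_mulC prodRing_mul1 prodRing_mulDl.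

End ProductRing.

Section Gorenstein.
Variable R : comPzRingType.

Definition surj (A B : lmodType R) (f : {linear A -> B}) : Prop :=
  forall y, exists x, f x = y.

(* A -f-> B -g-> C is exact at B. *)
Definition exact_at (A B C : lmodType R)
    (f : {linear A -> B}) (g : {linear B -> C}) : Prop :=
  forall y, g y = 0 <-> exists x, f x = y.

Definition projective (P : lmodType R) : Prop :=
  forall (A B : lmodType R) (g : {linear A -> B}) (f : {linear P -> B}),
    surj g -> exists h : {linear P -> A}, forall x, g (h x) = f x.

(* Sequences ... -> P (n+1) -d n-> P n -> ... are indexed homologically by int:
   P_n is P n and P^n is P (- n - 1) for n >= 0, so that P_0 -> P^0 is d (-1). *)
Definition exact_seq (P : int -> lmodType R)
    (d : forall n : int, {linear P (n + 1) -> P n}) : Prop :=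
  forall n, exact_at (d (n + 1)) (d n).

(* Exactness of Hom(P n, Q) -> Hom(P (n+1), Q) -> Hom(P (n+1+1), Q), the maps
   being precomposition with d n and d (n+1). *)
Definition hom_exact (P : int -> lmodType R)
    (d : forall n : int, {linear P (n + 1) -> P n}) (Q : lmodType R) : Prop :=
  forall (n : int) (g : {linear P (n + 1) -> Q}),
    (forall x, g (d (n + 1) x) = 0) <->
    exists h : {linear P n -> Q}, forall x, h (d n x) = g x.

(* The isomorphism of M with Im (P_0 -> P^0) is given as an injective linear
   map M -> P^0 with that image. *)
Definition Gprojective (M : lmodType R) : Prop :=
  exists (P : int -> lmodType R) (d : forall n : int, {linear P (n + 1) -> P n}),
    [/\ forall n, projective (P n),
        exact_seq d,
        forall Q : lmodType R, projective Q -> hom_exact d Q &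
        exists i : {linear M -> P (-1)}, injective i /\
          forall y, (exists x, i x = y) <-> (exists p, d (-1) p = y)].

(* There is an exact sequence 0 -> G_n -> ... -> G_0 -> M -> 0 with all G_i
   Gorenstein projective; it is extended by zero modules G_i for i > n. *)
Definition has_Gresolution (M : lmodType R) (n : nat) : Prop :=
  exists (G : nat -> lmodType R) (d : forall i : nat, {linear G i.+1 -> G i})
         (eps : {linear G 0%N -> M}),
    [/\ forall i, (i <= n)%N -> Gprojective (G i),
        forall i, (n < i)%N -> forall x : G i, x = 0,
        surj eps,
        exact_at (d 0%N) eps &
        forall i, exact_at (d i.+1) (d i)].

Definition Gpd (M : lmodType R) : enat := einf (has_Gresolution M).

End Gorenstein.

Definition Ggldim (R : comPzRingType) : enat := esup (@Gpd R).

(* Main.v *)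
(** A direct factor [T] of a ring [S], cut out by an idempotent [e], gives two
exact functors: [M |-> e M] from [S]-modules to [T]-modules, and restriction of
scalars back. Each is both a left and a right adjoint of the other, hence both
preserve projectives, totally acyclic complexes and Gorenstein projective
resolutions. As [M] is isomorphic to [e M] for every [T]-module [M], this gives
[Ggldim T <= Ggldim S]. If [1] is a finite sum of orthogonal such idempotents
[e_i], every [S]-module is the direct sum of its corners [e_i M], and resolutions
of length [n] of the corners add up to one of [M]. *)

Require Import Defs.
From HB Require Import structures.
From mathcomp Require Import all_boot all_order all_algebra.
From mathcomp Require Import boolp.

Set Implicit Arguments.
Unset Strict Implicit.
Unset Printing Implicit Defensive.

Import GRing.Theory.
Local Open Scope ring_scope.

(** * Choice, and finite bounds in [enat] *)

Lemma dependent_function_choice (I : Type) (T : I -> Type)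
    (Q : forall i, T i -> Prop) :
  (forall i, exists x, Q i x) -> exists f : forall i, T i, forall i, Q i (f i).
Proof. by move=> H; exists (fun i => sval (cid (H i))) => i; case: cid. Qed.

Lemma ele_trans (x y z : enat) : ele x y -> ele y z -> ele x z.
Proof. by case: x y z => [x|] [y|] [z|] //=; apply: leq_trans. Qed.

(** Reduces an equality of dimensions to a comparison of finite upper bounds, and each such bound
    can be expressed by the existence of resolutions of a given length. [Infty] is the value without
    finite bounds. *)
Lemma eq_enat_Fin (x y : enat) :
  (forall n, ele x (Fin n) <-> ele y (Fin n)) -> x = y.
Proof.
case: x y => [x|] [y|] //= xy.
- congr Fin; apply/eqP; rewrite eqn_leq.
  by rewrite (xy y).2 ?leqnn // (xy x).1 ?leqnn.
- by case: (xy x).1.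
- by case: (xy y).2.
Qed.

Lemma esup_Fin (I : Type) (f : I -> enat) (n : nat) :
  ele (esup f) (Fin n) <-> forall i, ele (f i) (Fin n).
Proof.
split=> [le_n i|]; last exact: esup_least.
by apply: ele_trans le_n; apply: esup_ub.
Qed.

(** * Gorenstein projective resolutions over a fixed ring *)

Section Modules.
Variable S : comPzRingType.
Implicit Types L M N P Q : lmodType S.

(** The constant complex at [M] with identity differentials serves: all its terms and all Hom groups
    out of them vanish. *)
Lemma Gprojective_zero M : (forall x : M, x = 0) -> Gprojective M.
Proof.
move=> M0; exists (fun=> M), (fun=> idfun); split.
- by move=> n A B g f _; exists \0 => x; rewrite (M0 x) !linear0.
- by move=> n y; split=> _; [exists y | exact: M0].
- move=> Q _ n g; split=> [_ | _ x]; last by rewrite (M0 x) linear0.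
  by exists g.
- exists idfun; split=> [x y _ | y]; first by rewrite (M0 x) (M0 y).
  by split=> _; exists y.
Qed.

(** The terms strictly above degree [k] are zero, hence Gorenstein projective, so the same sequence
    counts as one of length [n]. *)
Lemma has_Gresolution_leq M k n :
  (k <= n)%N -> has_Gresolution M k -> has_Gresolution M n.
Proof.
move=> le_kn [G [d [eps [Gproj G0 eps_surj ex0 ex]]]].
exists G, d, eps; split=> // i.
  move=> _; have [|lt_ki] := leqP i k; first exact: Gproj.
  exact/Gprojective_zero/G0.
by move=> lt_ni; apply/G0/(leq_ltn_trans le_kn).
Qed.

(** The minimum in [Gpd] is attained, and monotonicity in the length carries a shortest resolution
    up to [n]. *)
Lemma Gpd_Fin M n : ele (Gpd M) (Fin n) <-> has_Gresolution M n.
Proof.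
rewrite /Gpd /einf; case: pselect => [exP | noP] /=; last first.
  by split=> // Mn; apply: noP; exists n; apply/asboolP.
case: ex_minnP => k /asboolP Mk k_min; split=> [le_kn | Mn].
  exact: has_Gresolution_leq Mk.
by apply: k_min; apply/asboolP.
Qed.

(** Only the augmentation changes: it is composed with [f], and injectivity of [f] preserves its
    kernel. *)
Lemma has_Gresolution_bij M N (f : {linear M -> N}) n :
  injective f -> surj f -> has_Gresolution M n -> has_Gresolution N n.
Proof.
move=> f_inj f_surj [G [d [eps [Gproj G0 eps_surj ex0 ex]]]].
exists G, d, (f \o eps); split=> // y.
  have [x <-] := f_surj y; have [z <-] := eps_surj x.
  by exists z.
rewrite -(ex0 y) /=; split=> [|->]; last by rewrite linear0.
by rewrite -(linear0 f) => /f_inj.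
Qed.

End Modules.

Lemma Ggldim_Fin (S : comPzRingType) n :
  ele (Ggldim S) (Fin n) <-> forall M : lmodType S, has_Gresolution M n.
Proof.
by rewrite esup_Fin; split=> H M; [apply/Gpd_Fin | apply/Gpd_Fin].
Qed.

(** * Exact functors between module categories and their adjoints *)

Record exact_functor (A B : comPzRingType) := ExactFunctor {
  fobj :> lmodType A -> lmodType B;
  fmap : forall M N : lmodType A, {linear M -> N} -> {linear fobj M -> fobj N};
  fmap_exact : forall (L M N : lmodType A)
      (f : {linear L -> M}) (g : {linear M -> N}),
    exact_at f g -> exact_at (fmap f) (fmap g);
  fmap_surj : forall (M N : lmodType A) (f : {linear M -> N}),
    surj f -> surj (fmap f);
  fmap_inj : forall (M N : lmodType A) (f : {linear M -> N}),
    injective f -> injective (fmap f);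
  fmap_image : forall (L M N : lmodType A)
      (f : {linear L -> N}) (g : {linear M -> N}),
    (forall x, exists y, g y = f x) -> forall x, exists y, fmap g y = fmap f x;
  fobj_zero : forall M : lmodType A,
    (forall x : M, x = 0) -> forall x : fobj M, x = 0
}.

(* Weaker than an adjunction [F -| U]: [adjl] is only a one-sided inverse of the
   transposition [adjr], and the naturality of [adjr] is only required for zero
   composites. *)
Record adjunction (A B : comPzRingType)
    (F : exact_functor A B) (U : exact_functor B A) := Adjunction {
  adjr : forall (M : lmodType A) (N : lmodType B),
    {linear F M -> N} -> {linear M -> U N};
  adjl : forall (M : lmodType A) (N : lmodType B),
    {linear M -> U N} -> {linear F M -> N};
  adjrK : forall (M : lmodType A) (N : lmodType B) (g : {linear F M -> N}),
    adjl (adjr g) =1 g;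
  adjl_naturall : forall (L M : lmodType A) (N : lmodType B)
      (f : {linear L -> M}) (h : {linear M -> U N}) (k : {linear L -> U N}),
    (forall x, h (f x) = k x) ->
    forall x, adjl h (fmap F f x) = adjl k x;
  adjl_naturalr : forall (M : lmodType A) (N N' : lmodType B)
      (g : {linear N -> N'}) (h : {linear M -> U N}) (k : {linear M -> U N'}),
    (forall x, fmap U g (h x) = k x) -> forall x, g (adjl h x) = adjl k x;
  adjr_comp0 : forall (L M : lmodType A) (N : lmodType B)
      (f : {linear L -> M}) (g : {linear F M -> N}),
    (forall x, g (fmap F f x) = 0) -> forall x, adjr g (f x) = 0
}.

Section LeftAdjoint.
Variables (A B : comPzRingType) (F : exact_functor A B) (U : exact_functor B A).
Variable adj : adjunction F U.

(** Lifting a map [F P -> N] along [g] amounts to lifting its transpose [P -> U N] along [fmap U g],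
    which is again surjective. *)
Lemma left_adjoint_projective (P : lmodType A) :
  projective P -> projective (F P).
Proof.
move=> Pproj M N g f g_surj.
have [h hE] := Pproj _ _ (fmap U g) (adjr adj f) (fmap_surj g_surj).
by exists (adjl adj h) => x; rewrite (adjl_naturalr adj hE) adjrK.
Qed.

Hypothesis U_projective :
  forall Q : lmodType B, projective Q -> projective (U Q).

(** Apply [F] to the whole complex. Maps from its terms to a projective [Q] correspond to maps from
    the original terms to [U Q], which is projective by hypothesis, so Hom-exactness is
    inherited. *)
Lemma left_adjoint_Gprojective (M : lmodType A) :
  Gprojective M -> Gprojective (F M).
Proof.
move=> [P [d [Pproj ex hom_ex [i [i_inj im_i]]]]].
have Fex n : exact_at (fmap F (d (n + 1))) (fmap F (d n)).
  exact: fmap_exact (ex n).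
exists (fun n => F (P n)), (fun n => fmap F (d n)); split=> //.
- by move=> n; apply: left_adjoint_projective.
- move=> Q Qproj n g; split=> [gd0 | [h hE] x].
    have [h hE] := (hom_ex _ (U_projective Qproj) n (adjr adj g)).1
      (adjr_comp0 adj gd0).
    by exists (adjl adj h) => x; rewrite (adjl_naturall adj hE) adjrK.
  (* A map factoring through one differential kills the image of the preceding one. *)
  by rewrite -hE ((Fex n _).2 _) ?linear0 //; exists x.
- exists (fmap F i); split; first exact: fmap_inj.
  (* The equality of images is two inclusions, and [fmap_image] transports each of them. *)
  move=> y; split=> -[x <-]; apply: fmap_image => z; apply/im_i; by exists z.
Qed.

Lemma left_adjoint_has_Gresolution (M : lmodType A) n :
  has_Gresolution M n -> has_Gresolution (F M) n.
Proof.
move=> [G [d [eps [Gproj G0 eps_surj ex0 ex]]]].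
exists (fun i => F (G i)), (fun i => fmap F (d i)), (fmap F eps); split.
- by move=> i /Gproj; apply: left_adjoint_Gprojective.
- by move=> i /G0; apply: fobj_zero.
- exact: fmap_surj.
- exact: fmap_exact.
- by move=> i; apply: fmap_exact.
Qed.

End LeftAdjoint.

(** * Direct factors of a ring and restriction of scalars *)

Definition linear_of (S : comPzRingType) (M N : lmodType S) (f : M -> N)
    (lin_f : forall a : S, {morph f : x y / a *: x + y}) : {linear M -> N} :=
  HB.pack f (GRing.isLinear.Build S M N *:%R f lin_f).

Lemma linear_ofE (S : comPzRingType) (M N : lmodType S) (f : M -> N) lin_f x :
  @linear_of S M N f lin_f x = f x.
Proof. by []. Qed.

(* [T] is a direct factor of [S]: [df_inj] identifies [T] with the ideal of [S]
   generated by the idempotent [df_inj 1]. *)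
Record direct_factor (S T : comPzRingType) := DirectFactor {
  df_proj : {rmorphism S -> T};
  df_inj : {additive T -> S};
  df_injM : {morph df_inj : a b / a * b};
  df_injK : cancel df_inj df_proj;
  df_projK : forall s, df_inj (df_proj s) = df_inj 1 * s
}.

Section Restriction.
Variables (S T : comPzRingType) (c : direct_factor S T).

Section Object.
Variable M : lmodType T.

(* The argument [c] is a phantom that determines the action of [S] on [M]. *)
Definition res of direct_factor S T : Type := M.
Local Notation resM := (res c).

HB.instance Definition _ := GRing.Zmodule.on resM.

Definition res_scale (s : S) (x : resM) : resM := df_proj c s *: (x : M).

Fact res_scaleA a b x : res_scale a (res_scale b x) = res_scale (a * b) x.
Proof. by rewrite /res_scale scalerA rmorphM. Qed.
Fact res_scale1 : left_id 1 res_scale.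
Proof. by move=> x; rewrite /res_scale rmorph1 scale1r. Qed.
Fact res_scaleDr : right_distributive res_scale +%R.
Proof. by move=> a x y; rewrite /res_scale scalerDr. Qed.
Fact res_scaleDl x : {morph res_scale^~ x : a b / a + b}.
Proof. by move=> a b; rewrite /res_scale rmorphD scalerDl. Qed.

HB.instance Definition _ := GRing.Zmodule_isLmodule.Build S resM
  res_scaleA res_scale1 res_scaleDr res_scaleDl.

End Object.

Definition res_obj (M : lmodType T) : lmodType S := res M c.

Lemma res_scaleE (M : lmodType T) (s : S) (x : res_obj M) :
  s *: x = df_proj c s *: (x : M) :> M.
Proof. by []. Qed.

Fact res_map_linear (M N : lmodType T) (f : {linear M -> N}) (a : S) :
  {morph (f : res_obj M -> res_obj N) : x y / a *: x + y}.
Proof. by move=> x y; rewrite !res_scaleE; apply: linearP. Qed.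

(** Restriction changes neither the underlying groups nor the underlying functions, so each
    preservation property is its own hypothesis. *)
Definition res_functor : exact_functor T S.
Proof.
apply: (@ExactFunctor T S res_obj
  (fun M N f => linear_of (@res_map_linear M N f))) => //.
Defined.

End Restriction.

(** * The corner of a module cut out by an idempotent *)

Section Corner.
Variables (S T : comPzRingType) (c : direct_factor S T).

Local Notation e := (df_inj c 1).

Lemma df_idem : e * e = e.
Proof. by rewrite -df_injM mulr1. Qed.

Section Object.
Variable M : lmodType S.

Definition corner_pred : {pred M} := fun x => e *: x == x.

(** As [e] is idempotent, its fixed points form exactly the submodule [e M]; this form makes
    membership a decidable equation. *)
Lemma corner_predE (x : M) : (x \in corner_pred) = (e *: x == x).
Proof. by []. Qed.

Fact corner_zmod_closed : zmod_closed corner_pred.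
Proof.
split=> [|x y]; first by rewrite corner_predE scaler0.
by rewrite !corner_predE scalerBr => /eqP-> /eqP->.
Qed.
HB.instance Definition _ :=
  GRing.isZmodClosed.Build M corner_pred corner_zmod_closed.

Record corner := Corner {
  corner_val : M;
  corner_valP : corner_val \in corner_pred
}.

HB.instance Definition _ := [isSub for corner_val].
HB.instance Definition _ := [Choice of corner by <:].
HB.instance Definition _ := [SubChoice_isSubZmodule of corner by <:].

Lemma corner_val_inj : injective corner_val.
Proof. exact: val_inj. Qed.

Lemma corner_idem (x : corner) : e *: corner_val x = corner_val x.
Proof. exact: eqP (corner_valP x). Qed.

(** The inner factor [e] lets one closure fact provide both the projection of [M] onto its corner
    ([t = 1]) and the [T]-action, where that factor acts trivially. *)
Fact corner_inj_subproof (t : T) (x : M) :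
  df_inj c t *: (e *: x) \in corner_pred.
Proof. by rewrite corner_predE !scalerA -!df_injM mul1r !mulr1. Qed.

Definition corner_proj (x : M) : corner := Corner (corner_inj_subproof 1 x).

Lemma corner_projE x : corner_val (corner_proj x) = e *: x.
Proof. by rewrite /= scalerA df_idem. Qed.

Lemma corner_projK (x : corner) : corner_proj (corner_val x) = x.
Proof. by apply/corner_val_inj; rewrite /= !corner_idem. Qed.

Definition corner_scale (t : T) (x : corner) : corner :=
  Corner (corner_inj_subproof t (corner_val x)).

Lemma corner_scale_val t x :
  corner_val (corner_scale t x) = df_inj c t *: corner_val x.
Proof. by rewrite /= corner_idem. Qed.

Lemma corner_valD (x y : corner) :
  corner_val (x + y) = corner_val x + corner_val y.
Proof. by []. Qed.

Fact corner_scaleA a b x :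
  corner_scale a (corner_scale b x) = corner_scale (a * b) x.
Proof. by apply/corner_val_inj; rewrite !corner_scale_val scalerA df_injM. Qed.
Fact corner_scale1 : left_id 1 corner_scale.
Proof.
by move=> x; apply/corner_val_inj; rewrite corner_scale_val corner_idem.
Qed.
Fact corner_scaleDr : right_distributive corner_scale +%R.
Proof.
move=> a x y; apply/corner_val_inj.
by rewrite !(corner_valD, corner_scale_val) scalerDr.
Qed.
Fact corner_scaleDl x : {morph corner_scale^~ x : a b / a + b}.
Proof.
move=> a b; apply/corner_val_inj.
by rewrite !(corner_valD, corner_scale_val) raddfD scalerDl.
Qed.

HB.instance Definition _ := GRing.Zmodule_isLmodule.Build T corner
  corner_scaleA corner_scale1 corner_scaleDr corner_scaleDl.

Lemma corner_valZ (t : T) (x : corner) :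
  corner_val (t *: x) = df_inj c t *: corner_val x.
Proof. exact: corner_scale_val. Qed.

Lemma corner_val_linear (t : T) (x y : corner) :
  corner_val (t *: x + y) = df_inj c t *: corner_val x + corner_val y.
Proof. by rewrite corner_valD corner_valZ. Qed.

(** Since [e] fixes the corner, [s] and [e * s] act alike on it: the action of [S] there factors
    through [T]. *)
Lemma corner_val_proj (s : S) (x : corner) :
  df_inj c (df_proj c s) *: corner_val x = s *: corner_val x.
Proof. by rewrite df_projK mulrC -scalerA corner_idem. Qed.

End Object.

Lemma corner_map_closed (M N : lmodType S) (f : {linear M -> N})
    (x : corner M) :
  f (corner_val x) \in @corner_pred N.
Proof. by rewrite corner_predE -linearZ /= corner_idem. Qed.

Fact corner_map_linear (M N : lmodType S) (f : {linear M -> N}) (a : T) :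
  {morph (fun x : corner M => Corner (corner_map_closed f x)) :
    x y / a *: x + y}.
Proof.
move=> x y; apply/corner_val_inj.
rewrite [RHS]corner_val_linear.
exact: etrans (congr1 f (corner_val_linear a x y)) (linearP f _ _ _).
Qed.

Definition corner_map (M N : lmodType S) (f : {linear M -> N}) :
  {linear corner M -> corner N} := linear_of (corner_map_linear f).

Lemma corner_mapE (M N : lmodType S) (f : {linear M -> N}) (x : corner M) :
  corner_val (corner_map f x) = f (corner_val x).
Proof. by []. Qed.

Lemma corner_map_proj (M N : lmodType S) (f : {linear M -> N}) (x : M) :
  corner_map f (corner_proj x) = corner_proj (f x).
Proof. by apply/corner_val_inj; rewrite corner_mapE !corner_projE linearZ. Qed.

(** Preimages are found in the ambient module and then multiplied by [e]; [corner_map_proj] shows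
    that they remain preimages. *)
Definition corner_functor : exact_functor S T.
Proof.
apply: (@ExactFunctor S T corner corner_map).
- move=> L M N f g ex y; split=> [gy0 | [x <-]].
    have [x fx] := (ex (corner_val y)).1 (congr1 (@corner_val _) gy0).
    by exists (corner_proj x); rewrite corner_map_proj fx corner_projK.
  by apply/corner_val_inj/ex; exists (corner_val x).
- move=> M N f f_surj y; have [x fx] := f_surj (corner_val y).
  by exists (corner_proj x); rewrite corner_map_proj fx corner_projK.
- move=> M N f f_inj x y /(congr1 (@corner_val _)) fxy.
  exact/corner_val_inj/f_inj.
- move=> L M N f g im_fg x; have [y gy] := im_fg (corner_val x).
  exists (corner_proj y); rewrite corner_map_proj gy.
  exact: (corner_projK (corner_map f x)).
- by move=> M M0 x; apply/corner_val_inj/M0.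
Defined.

(** * The two adjunctions between corner and restriction *)

Section Transpose.
Variables (M : lmodType S) (N : lmodType T).

Fact corner_to_res_linear (g : {linear corner M -> N}) (a : S) :
  {morph (fun x : M => g (corner_proj x) : res_obj c N) : x y / a *: x + y}.
Proof.
move=> x y; rewrite res_scaleE -linearP; congr (g _); apply/corner_val_inj.
rewrite corner_valD corner_valZ !corner_projE df_projK.
by rewrite scalerDr !scalerA -mulrA (mulrC a) mulrA df_idem.
Qed.

Fact corner_of_res_linear (h : {linear M -> res_obj c N}) (a : T) :
  {morph (fun x : corner M => h (corner_val x) : N) : x y / a *: x + y}.
Proof.
move=> x y; rewrite corner_valD corner_valZ.
by rewrite linearD linearZ /= res_scaleE df_injK.
Qed.

(** On a restricted module [e] acts as [df_proj c e = 1], and [g] commutes with [e], so its values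
    are fixed by [e]. *)
Fact res_to_corner_closed (g : {linear res_obj c N -> M}) (x : N) :
  g x \in @corner_pred M.
Proof. by rewrite corner_predE -linearZ /= res_scaleE df_injK scale1r. Qed.

Fact res_to_corner_linear (g : {linear res_obj c N -> M}) (a : T) :
  {morph (fun x : N => Corner (res_to_corner_closed g x)) : x y / a *: x + y}.
Proof.
move=> x y; apply/corner_val_inj; rewrite corner_valD corner_valZ /=.
by rewrite -linearP; congr (g (_ + _)); rewrite res_scaleE df_injK.
Qed.

Fact res_of_corner_linear (h : {linear N -> corner M}) (a : S) :
  {morph (fun x : res_obj c N => corner_val (h x) : M) : x y / a *: x + y}.
Proof.
move=> x y; rewrite res_scaleE linearP corner_valD corner_valZ.
by rewrite corner_val_proj.
Qed.

End Transpose.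

Definition corner_res_adjunction : adjunction corner_functor (res_functor c).
Proof.
apply: (@Adjunction S T corner_functor (res_functor c)
  (fun M N g => linear_of (@corner_to_res_linear M N g))
  (fun M N h => linear_of (@corner_of_res_linear M N h))) => //.
- by move=> M N g x; congr (g _); apply: corner_projK.
- by move=> L M N f h k hk x; apply: hk.
- by move=> M N N' g h k hk x; apply: hk.
- move=> L M N f g gf0 x.
  exact: etrans (congr1 g (esym (corner_map_proj f x))) (gf0 _).
Defined.

Definition res_corner_adjunction : adjunction (res_functor c) corner_functor.
Proof.
apply: (@Adjunction T S (res_functor c) corner_functor
  (fun N M g => linear_of (@res_to_corner_linear M N g))
  (fun N M h => linear_of (@res_of_corner_linear M N h))) => //.
- by move=> L M N f h k hk x; rewrite /= -hk.
- by move=> M N N' g h k hk x; rewrite /= -hk.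
- by move=> L M N f g gf0 x; apply/corner_val_inj/gf0.
Defined.

(** One adjunction moves the resolution. The other makes restriction a left adjoint as well, so that
    it preserves the projective test modules. *)
Lemma corner_has_Gresolution (M : lmodType S) n :
  has_Gresolution M n -> has_Gresolution (corner M) n.
Proof.
apply: (left_adjoint_has_Gresolution corner_res_adjunction).
by move=> Q; apply: (left_adjoint_projective res_corner_adjunction).
Qed.

Lemma res_has_Gresolution (M : lmodType T) n :
  has_Gresolution M n -> has_Gresolution (res_obj c M) n.
Proof.
apply: (left_adjoint_has_Gresolution res_corner_adjunction).
by move=> Q; apply: (left_adjoint_projective corner_res_adjunction).
Qed.

(** This map is the counit of [corner_res_adjunction]; it is bijective because [e] acts as the
    identity on a restricted module. *)
Fact res_corner_counit_linear (M : lmodType T) (a : T) :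
  {morph (fun x : corner (res_obj c M) => corner_val x : M) : x y / a *: x + y}.
Proof. by move=> x y; rewrite corner_valD corner_valZ res_scaleE df_injK. Qed.

Lemma Ggldim_direct_factor : ele (Ggldim T) (Ggldim S).
Proof.
case E: (Ggldim S) => [n|]; last by case: (Ggldim T).
apply/Ggldim_Fin => M.
have SM : has_Gresolution (res_obj c M) n.
  by have /Ggldim_Fin : ele (Ggldim S) (Fin n) by rewrite E /=.
apply: (@has_Gresolution_bij _ _ _ (linear_of (@res_corner_counit_linear M)) _
  _ _ (corner_has_Gresolution SM)).
- exact: corner_val_inj.
- move=> x; exists (corner_proj (x : res_obj c M)); rewrite linear_ofE.
  by rewrite corner_projE res_scaleE df_injK scale1r.
Qed.

End Corner.

(** * Finite direct sums of modules and of resolutions *)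

Section DirectSum.
Variables (S : comPzRingType) (I : finType).

Section Object.
Variable M : I -> lmodType S.

Definition dsum : Type := {dffun forall i, M i}.

HB.instance Definition _ := Choice.on dsum.

Implicit Types x y z : dsum.

Definition dsum_zero : dsum := [ffun i : I => 0 : M i].
Definition dsum_opp x : dsum := [ffun i : I => - x i].
Definition dsum_add x y : dsum := [ffun i : I => x i + y i].
Definition dsum_scale (a : S) x : dsum := [ffun i : I => a *: x i].

Fact dsum_addA : associative dsum_add.
Proof. by move=> x y z; apply/ffunP => i; rewrite !ffunE addrA. Qed.
Fact dsum_addC : commutative dsum_add.
Proof. by move=> x y; apply/ffunP => i; rewrite !ffunE addrC. Qed.
Fact dsum_add0 : left_id dsum_zero dsum_add.
Proof. by move=> x; apply/ffunP => i; rewrite !ffunE add0r. Qed.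
Fact dsum_addN : left_inverse dsum_zero dsum_opp dsum_add.
Proof. by move=> x; apply/ffunP => i; rewrite !ffunE addNr. Qed.

HB.instance Definition _ := GRing.isZmodule.Build dsum
  dsum_addA dsum_addC dsum_add0 dsum_addN.

Fact dsum_scaleA a b x : dsum_scale a (dsum_scale b x) = dsum_scale (a * b) x.
Proof. by apply/ffunP => i; rewrite !ffunE scalerA. Qed.
Fact dsum_scale1 : left_id 1 dsum_scale.
Proof. by move=> x; apply/ffunP => i; rewrite !ffunE scale1r. Qed.
Fact dsum_scaleDr : right_distributive dsum_scale +%R.
Proof. by move=> a x y; apply/ffunP => i; rewrite !ffunE scalerDr. Qed.
Fact dsum_scaleDl x : {morph dsum_scale^~ x : a b / a + b}.
Proof. by move=> a b; apply/ffunP => i; rewrite !ffunE scalerDl. Qed.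

HB.instance Definition _ := GRing.Zmodule_isLmodule.Build S dsum
  dsum_scaleA dsum_scale1 dsum_scaleDr dsum_scaleDl.

Lemma dsum_linE (a : S) x y i : (a *: x + y : dsum) i = a *: x i + y i.
Proof. by rewrite !ffunE. Qed.

Lemma dsum0E i : (0 : dsum) i = 0.
Proof. by rewrite ffunE. Qed.

Lemma dsum_sumE J (r : seq J) (F : J -> dsum) i :
  (\sum_(j <- r) F j) i = \sum_(j <- r) F j i.
Proof. by elim/big_rec2: _ => [|j y x _ <-]; rewrite ?dsum0E // ffunE. Qed.

(** [dfwith] puts [x] at index [i] without an explicit cast along an equality of indices. *)
Definition dsum_inj_fun i (x : M i) : dsum :=
  [ffun j => dfwith (fun k => 0 : M k) x j].

Lemma dsum_inj_same i (x : M i) : dsum_inj_fun x i = x.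
Proof. by rewrite ffunE dfwith_in. Qed.

Lemma dsum_inj_other i j (x : M i) : i != j -> dsum_inj_fun x j = 0.
Proof. by move=> ij; rewrite ffunE dfwith_out. Qed.

Lemma dsum_inj_linear i (a : S) :
  {morph @dsum_inj_fun i : x y / a *: x + y}.
Proof.
move=> x y; apply/ffunP => j; rewrite dsum_linE.
have [<-|ij] := eqVneq i j; first by rewrite !dsum_inj_same.
by rewrite !dsum_inj_other // scaler0 addr0.
Qed.

Definition dsum_inj i : {linear M i -> dsum} := linear_of (@dsum_inj_linear i).

Lemma dsum_sum_inj x : \sum_i dsum_inj i (x i) = x.
Proof.
apply/ffunP => i; rewrite dsum_sumE (bigD1 i) //= dsum_inj_same big1 ?addr0 //.
by move=> j ji; rewrite dsum_inj_other.
Qed.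

Section Cotuple.
Variables (N : lmodType S) (f : forall i, {linear M i -> N}).

Lemma dsum_cotuple_linear (a : S) :
  {morph (fun x : dsum => \sum_i f i (x i)) : x y / a *: x + y}.
Proof.
move=> x y; rewrite scaler_sumr -big_split; apply: eq_bigr => i _.
by rewrite dsum_linE linearP.
Qed.

Definition dsum_cotuple : {linear dsum -> N} := linear_of dsum_cotuple_linear.

Lemma dsum_cotupleE x : dsum_cotuple x = \sum_i f i (x i).
Proof. by []. Qed.
End Cotuple.

Lemma linear_dsum (N : lmodType S) (g : {linear dsum -> N}) x :
  g x = \sum_i g (dsum_inj i (x i)).
Proof. by rewrite -linear_sum dsum_sum_inj. Qed.

End Object.

Lemma dsum_map_linear (M N : I -> lmodType S)
    (f : forall i, {linear M i -> N i}) (a : S) :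
  {morph (fun x : dsum M => [ffun i => f i (x i)] : dsum N) : x y / a *: x + y}.
Proof. by move=> x y; apply/ffunP => i; rewrite !dsum_linE !ffunE linearP. Qed.

Definition dsum_map (M N : I -> lmodType S)
    (f : forall i, {linear M i -> N i}) :
  {linear dsum M -> dsum N} := linear_of (dsum_map_linear f).

Lemma dsum_mapE (M N : I -> lmodType S)
    (f : forall i, {linear M i -> N i}) (x : dsum M) i :
  dsum_map f x i = f i (x i).
Proof. by rewrite linear_ofE ffunE. Qed.

Lemma dsum_map_inj (M N : I -> lmodType S)
    (f : forall i, {linear M i -> N i}) i (x : M i) :
  dsum_map f (dsum_inj M i x) = dsum_inj N i (f i x).
Proof.
apply/ffunP => j; rewrite dsum_mapE.
have [<-|ij] := eqVneq i j; first by rewrite !dsum_inj_same.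
by rewrite !dsum_inj_other // linear0.
Qed.

(** Preimages are chosen in each component and assembled. Surjectivity, exactness and comparison of
    images for direct sums all reduce to this. *)
Lemma dsum_map_image (M N : I -> lmodType S)
    (f : forall i, {linear M i -> N i}) (y : dsum N) :
  (exists x, dsum_map f x = y) <-> forall i, exists x, f i x = y i.
Proof.
split=> [[x <-] i | /dependent_function_choice[x xE]].
  by exists (x i); rewrite dsum_mapE.
by exists (finfun x); apply/ffunP => i; rewrite dsum_mapE ffunE xE.
Qed.

Lemma dsum_map_exact (L M N : I -> lmodType S)
    (f : forall i, {linear L i -> M i})
    (g : forall i, {linear M i -> N i}) :
  (forall i, exact_at (f i) (g i)) -> exact_at (dsum_map f) (dsum_map g).
Proof.
move=> ex y; rewrite dsum_map_image; split=> [gy0 i | im_y].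
  by apply/ex; rewrite -dsum_mapE gy0 dsum0E.
by apply/ffunP => i; rewrite dsum_mapE dsum0E; apply/ex.
Qed.

(** Lifts are chosen on the summands and glued by the universal property of the direct sum. *)
Lemma dsum_projective (P : I -> lmodType S) :
  (forall i, projective (P i)) -> projective (dsum P).
Proof.
move=> Pproj A B g f g_surj.
have [|h hE] := @dependent_function_choice I (fun i => {linear P i -> A})
    (fun i h => forall x, g (h x) = f (dsum_inj P i x)).
  by move=> i; apply: (Pproj i A B g (f \o dsum_inj P i) g_surj).
exists (dsum_cotuple h) => x.
by rewrite linear_sum (linear_dsum f); apply: eq_bigr.
Qed.

(** The complexes are added degreewise. A map from a direct sum to [Q] is a family of maps from the
    summands, so Hom-exactness is tested on each summand. *)
Lemma dsum_Gprojective (M : I -> lmodType S) :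
  (forall i, Gprojective (M i)) -> Gprojective (dsum M).
Proof.
move=> /dependent_function_choice[P /dependent_function_choice[d Pd]].
have dex n : exact_at (dsum_map (fun i => d i (n + 1)))
    (dsum_map (fun i => d i n)).
  by apply: dsum_map_exact => i; have [_ + _ _] := Pd i; apply.
exists (fun n => dsum (fun i => P i n)), (fun n => dsum_map (fun i => d i n)).
split=> //.
- by move=> n; apply: dsum_projective => i; have [+ _ _ _] := Pd i; apply.
- move=> Q Qproj n g; split=> [gd0 | [h hE] x]; last first.
    by rewrite -hE ((dex n _).2 _) ?linear0 //; exists x.
  have [|h hE] := @dependent_function_choice I (fun i => {linear P i n -> Q})
      (fun i h => forall x, h (d i n x) = g (dsum_inj _ i x)).
    move=> i; have [_ _ hom_ex _] := Pd i.
    apply: (hom_ex Q Qproj n (g \o dsum_inj _ i)).1 => x.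
    (* The inclusions of the summands commute with the differentials, so each component of [g] is
       again a cocycle. *)
    exact: etrans
      (congr1 g (esym (dsum_map_inj (fun i => d i (n + 1)) x))) (gd0 _).
  exists (dsum_cotuple h) => x; rewrite (linear_dsum g) dsum_cotupleE.
  by apply: eq_bigr => i _; rewrite dsum_mapE.
- have [|j jP] := @dependent_function_choice I
      (fun i => {linear M i -> P i (-1)})
      (fun i j => injective j /\
         forall y, (exists x, j x = y) <-> (exists p, d i (-1) p = y)).
    by move=> i; have [] := Pd i.
  exists (dsum_map j); split=> [x y jxy | y].
    apply/ffunP => i; apply: (jP i).1.
    by rewrite -!dsum_mapE jxy.
  by rewrite !dsum_map_image; split=> im_y i; apply/(jP i).2.
Qed.

Lemma dsum_has_Gresolution (M : I -> lmodType S) n :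
  (forall i, has_Gresolution (M i) n) -> has_Gresolution (dsum M) n.
Proof.
move=> /dependent_function_choice[G /dependent_function_choice[d]].
move=> /dependent_function_choice[eps Geps].
exists (fun k => dsum (fun i => G i k)), (fun k => dsum_map (fun i => d i k)).
exists (dsum_map eps); split.
- move=> k le_kn; apply: dsum_Gprojective => i.
  by have [+ _ _ _ _] := Geps i; apply.
- move=> k lt_nk x; apply/ffunP => i; rewrite dsum0E.
  by have [_ + _ _ _] := Geps i; apply.
- by move=> y; apply/dsum_map_image => i; have [_ _ + _ _] := Geps i; apply.
- by apply: dsum_map_exact => i; have [] := Geps i.
- by move=> k; apply: dsum_map_exact => i; have [_ _ _ _] := Geps i; apply.
Qed.

End DirectSum.

(** * Rings decomposed by orthogonal idempotents *)

Section Decomposition.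
Variables (S : comPzRingType) (I : finType) (R : I -> comPzRingType).
Variable c : forall i, direct_factor S (R i).
Hypothesis df_orthogonal :
  forall i j, i != j -> df_inj (c i) 1 * df_inj (c j) 1 = 0.
Hypothesis df_sum1 : \sum_i df_inj (c i) 1 = 1.

Lemma has_Gresolution_corners (M : lmodType S) n :
  (forall i, has_Gresolution (corner (c i) M) n) -> has_Gresolution M n.
Proof.
move=> cM_n; pose e i := df_inj (c i) 1.
(* Transposing the identity of the corner gives its inclusion into [M], so [f] is the summation map
   from the direct sum of the corners. *)
pose f := dsum_cotuple (fun i =>
  linear_of (res_of_corner_linear
    (idfun : {linear corner (c i) M -> corner (c i) M}))).
(* Orthogonality makes [e i] recover the component at [i], whence injectivity of [f]. *)
have fE x i : e i *: f x = corner_val (x i).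
  rewrite scaler_sumr (bigD1 i) //= corner_idem big1 ?addr0 // => j ji.
  by rewrite -corner_idem scalerA df_orthogonal ?scale0r // eq_sym.
apply: (@has_Gresolution_bij _ _ _ f).
- by move=> x y fxy; apply/ffunP => i; apply/corner_val_inj; rewrite -!fE fxy.
(* The preimage expresses [y] as the sum of the [e i *: y], using that the idempotents sum to 1. *)
- move=> y; exists [ffun i => corner_proj (c i) y].
  rewrite -[RHS]scale1r -df_sum1 scaler_suml; apply: eq_bigr => i _.
  by rewrite ffunE linear_ofE corner_projE.
- by apply: dsum_has_Gresolution => i; apply/res_has_Gresolution.
Qed.

Lemma Ggldim_decomposition : Ggldim S = esup (fun i => Ggldim (R i)).
Proof.
apply: eq_enat_Fin => n; rewrite esup_Fin; split=> [Sn i | Rn].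
  exact: ele_trans (Ggldim_direct_factor (c i)) Sn.
apply/Ggldim_Fin => M; apply: has_Gresolution_corners => i.
by have /Ggldim_Fin := Rn i.
Qed.

End Decomposition.

(** * The factors of a finite product ring *)

Section ProductFactors.
Variables (I : finType) (R : I -> comPzRingType).

Definition prodRing_inj_fun i (a : R i) : prodRing R :=
  [ffun j => dfwith (fun k => 0 : R k) a j].

Lemma prodRing_inj_same i (a : R i) : prodRing_inj_fun a i = a.
Proof. by rewrite ffunE dfwith_in. Qed.

Lemma prodRing_inj_other i j (a : R i) : i != j -> prodRing_inj_fun a j = 0.
Proof. by move=> ij; rewrite ffunE dfwith_out. Qed.

Variable i : I.

Definition prodRing_proj_fun (x : prodRing R) : R i := x i.

Fact prodRing_proj_zmod : zmod_morphism prodRing_proj_fun.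
Proof. by move=> x y; rewrite /prodRing_proj_fun !ffunE. Qed.
Fact prodRing_proj_monoid : monoid_morphism prodRing_proj_fun.
Proof. by split=> [|x y]; rewrite /prodRing_proj_fun ffunE. Qed.
HB.instance Definition _ :=
  GRing.isZmodMorphism.Build _ _ prodRing_proj_fun prodRing_proj_zmod.
HB.instance Definition _ :=
  GRing.isMonoidMorphism.Build _ _ prodRing_proj_fun prodRing_proj_monoid.

Fact prodRing_inj_zmod : zmod_morphism (@prodRing_inj_fun i).
Proof.
move=> a b; apply/ffunP => j; rewrite !ffunE.
by case: dfwithP => [|k ik]; rewrite ?dfwith_in // !dfwith_out // subr0.
Qed.
HB.instance Definition _ :=
  GRing.isZmodMorphism.Build _ _ (@prodRing_inj_fun i) prodRing_inj_zmod.

Fact prodRing_injM : {morph @prodRing_inj_fun i : a b / a * b}.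
Proof.
move=> a b; apply/ffunP => j; rewrite !ffunE.
by case: dfwithP => [|k ik]; rewrite ?dfwith_in // !dfwith_out // mulr0.
Qed.

Fact prodRing_projK (x : prodRing R) :
  prodRing_inj_fun (prodRing_proj_fun x) = prodRing_inj_fun (1 : R i) * x.
Proof.
apply/ffunP => j; rewrite !ffunE.
by case: dfwithP => [|k ik]; rewrite ?dfwith_in ?mul1r // !dfwith_out // mul0r.
Qed.

Definition prodRing_factor : direct_factor (prodRing R) (R i) :=
  @DirectFactor _ _ prodRing_proj_fun (@prodRing_inj_fun i)
    prodRing_injM (@prodRing_inj_same i) prodRing_projK.

End ProductFactors.

Theorem theorem3p1 (m : nat) (hm : (1 <= m)%N) (R : 'I_m -> comPzRingType) :
  Ggldim (prodRing R) = esup (fun i : 'I_m => Ggldim (R i)).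
Proof.
apply: (Ggldim_decomposition (c := prodRing_factor R)) => [i j ij|] /=.
  (* At coordinate [k] the first idempotent vanishes unless [k = i], and then the second one
     does. *)
  apply/ffunP => k; rewrite !ffunE.
  have [<-|ik] := eqVneq i k; last by rewrite dfwith_out // mul0r.
  by rewrite dfwith_in dfwith_out ?mulr0 // eq_sym.
(* Evaluation at [k] is read as the additive projection so that it passes through the sum, where
   only the term at [k] survives. *)
apply/ffunP => k; rewrite -[LHS]/(prodRing_proj_fun k _) raddf_sum.
rewrite (bigD1 k) //= /prodRing_proj_fun prodRing_inj_same big1 ?addr0 ?ffunE // => j jk.
by rewrite prodRing_inj_other.
Qed.
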